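(* Fix integers $k,m\ge 1$. There is a deterministic algorithm which, given non-zero $t$-sparse polynomials $f_1,\dots,f_m\in\mathbb{R}[X]$ in sparse representation (list of coefficients and exponents) and non-negative integers $\alpha_{ij}$ ($1\le i\le k$, $1\le j\le m$), decides whether the polynomial \[\phi=\sum_{i=1}^k\prod_{j=1}^m f_j^{\alpha_{ij}}\] is identically zero, in time polynomial in $t$, in the size of the sparse representations of the $f_j$, and in the values of the $\alpha_{ij}$.
   Context: A polynomial is $t$-sparse if it has at most $t$ monomials. The algorithm receives the explicit representation of $\phi$ above as input (it is not a black-box algorithm). *)

(* Defs.v *)
From HB Require Import structures.
From mathcomp Require Import all_boot all_order all_algebra.
From mathcomp Require Import reals.

Set Implicit Arguments.
Unset Strict Implicit.
Unset Printing Implicit Defensive.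

Import Order.TTheory GRing.Theory Num.Theory.
Local Open Scope ring_scope.

(* Algorithms are programs of a WHILE language over binary trees (Jones),
   whose atoms are natural numbers and real numbers.  Real arithmetic and real
   comparisons have unit cost, as in the Blum-Shub-Smale and real RAM models;
   arithmetic on natural numbers is charged the binary length of the operands
   (logarithmic cost).  There is no operation from reals to naturals (no
   floor), and programs contain no real constants. *)

Inductive value (R : Type) : Type :=
| VNil
| VNat of nat
| VReal of R
| VCons of value R & value R.

Arguments VNil {R}.
Arguments VNat {R}.

Inductive natop := NAdd | NSub | NMul | NDiv.
Inductive realop := RAdd | RSub | RMul | RDiv.

Inductive expr : Type :=
| EVar of nat
| ENil
| ECons of expr & expr
| EHd of expr
| ETl of expr
| ENat of nat
| ENatOp of natop & expr & expr
| ENatLe of expr & expr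
| ENatToReal of expr
| ERealOp of realop & expr & expr
| ERealLe of expr & expr.

Inductive cmd : Type :=
| CSkip
| CAssign of nat & expr
| CSeq of cmd & cmd
| CIf of expr & cmd & cmd
| CWhile of expr & cmd.

Definition bitlen (n : nat) : nat := (trunc_log 2 n).+1.

Section Semantics.
Variable R : realType.

Definition store := nat -> value R.

Definition upd (s : store) (x : nat) (v : value R) : store :=
  fun y => if y == x then v else s y.

Definition truth (v : value R) : bool := if v is VNil then false else true.

Definition vbool (b : bool) : value R := if b then VCons VNil VNil else VNil.

Definition vhd (v : value R) : value R := if v is VCons a _ then a else VNil.
Definition vtl (v : value R) : value R := if v is VCons _ b then b else VNil.

Definition eval_natop (o : natop) (a b : nat) : nat :=
  match o with
  | NAdd => a + b | NSub => a - b | NMul => a * b | NDiv => a %/ b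
  end%N.

(* Ill-typed operations, and real division by zero, return [VNil]. *)
Definition eval_realop (o : realop) (x y : R) : value R :=
  match o with
  | RAdd => VReal (x + y)
  | RSub => VReal (x - y)
  | RMul => VReal (x * y)
  | RDiv => if y == 0 then VNil else VReal (x / y)
  end.

Fixpoint eval (s : store) (e : expr) : value R :=
  match e with
  | EVar x => s x
  | ENil => VNil
  | ECons e1 e2 => VCons (eval s e1) (eval s e2)
  | EHd e1 => vhd (eval s e1)
  | ETl e1 => vtl (eval s e1)
  | ENat n => VNat n
  | ENatOp o e1 e2 =>
      match eval s e1, eval s e2 with
      | VNat a, VNat b => VNat (eval_natop o a b)
      | _, _ => VNil
      end
  | ENatLe e1 e2 =>
      match eval s e1, eval s e2 with
      | VNat a, VNat b => vbool (a <= b)%N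
      | _, _ => VNil
      end
  | ENatToReal e1 => if eval s e1 is VNat a then VReal a%:R else VNil
  | ERealOp o e1 e2 =>
      match eval s e1, eval s e2 with
      | VReal x, VReal y => eval_realop o x y
      | _, _ => VNil
      end
  | ERealLe e1 e2 =>
      match eval s e1, eval s e2 with
      | VReal x, VReal y => vbool (x <= y)
      | _, _ => VNil
      end
  end.

Definition nat_cost (v : value R) : nat := if v is VNat n then bitlen n else 0.

Fixpoint ecost (s : store) (e : expr) : nat :=
  match e with
  | EVar _ | ENil | ENat _ => 1
  | ECons e1 e2 | ERealOp _ e1 e2 | ERealLe e1 e2 =>
      (ecost s e1 + ecost s e2).+1
  | EHd e1 | ETl e1 => (ecost s e1).+1
  | ENatToReal e1 => (ecost s e1 + nat_cost (eval s e1)).+1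
  | ENatOp _ e1 e2 | ENatLe e1 e2 =>
      (ecost s e1 + ecost s e2
       + nat_cost (eval s e1) + nat_cost (eval s e2)).+1
  end%N.

(* [exec c s n s']: started in store [s], the command [c] halts in store [s']
   after a computation of total cost [n]. *)
Inductive exec : cmd -> store -> nat -> store -> Prop :=
| exec_skip s : exec CSkip s 1 s
| exec_assign s x e :
    exec (CAssign x e) s (ecost s e).+1 (upd s x (eval s e))
| exec_seq c1 c2 s n1 s1 n2 s2 :
    exec c1 s n1 s1 -> exec c2 s1 n2 s2 ->
    exec (CSeq c1 c2) s (n1 + n2).+1 s2
| exec_if e c1 c2 s n s' :
    exec (if truth (eval s e) then c1 else c2) s n s' ->
    exec (CIf e c1 c2) s (ecost s e + n).+1 s'
| exec_while_false e c s :
    truth (eval s e) = false ->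
    exec (CWhile e c) s (ecost s e).+1 s
| exec_while_true e c s n1 s1 n2 s2 :
    truth (eval s e) = true ->
    exec c s n1 s1 -> exec (CWhile e c) s1 n2 s2 ->
    exec (CWhile e c) s (ecost s e + n1 + n2).+1 s2.

Lemma exec_det c s n1 s1 n2 s2 :
  exec c s n1 s1 -> exec c s n2 s2 -> n1 = n2 /\ s1 = s2.
Proof.
move=> h; elim: h n2 s2 => {c s n1 s1}.
all: intros; match goal with H : exec _ _ ?n ?s |- _ = ?n /\ _ = ?s =>
  inversion H; subst; clear H end => //; try congruence.
all: repeat match goal with
  | IH : forall n s, exec ?c ?s0 n s -> _, H : exec ?c ?s0 _ _ |- _ =>
    case: (IH _ _ H) => ? ?; subst; clear IH end; by [].
Qed.

(* The input is placed in variable 0 (all other variables hold [VNil]), and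
   the answer is the truth value of variable 0 on halting. *)
Definition runs (P : cmd) (v : value R) (b : bool) (n : nat) : Prop :=
  exists2 s' : store,
    exec P (upd (fun=> VNil) 0 v) n s' & truth (s' 0%N) = b.

Definition t_sparse (t : nat) (f : {poly R}) : Prop :=
  (count (fun c : R => c != 0%R) f <= t)%N.

(* A sparse representation lists each monomial once, in any order, as a pair
   (coefficient, exponent). *)
Definition sparse_rep (l : seq (R * nat)) (f : {poly R}) : Prop :=
  [/\ uniq [seq u.2 | u <- l],
      (forall u, u \in l -> u.1 != 0) &
      f = \sum_(u <- l) u.1 *: 'X^(u.2)].

(* A real coefficient has size 1, an exponent its binary length. *)
Definition sparse_size (l : seq (R * nat)) : nat :=
  (\sum_(u <- l) (1 + bitlen u.2))%N.

Definition vlist (l : seq (value R)) : value R :=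
  foldr (@VCons R) VNil l.

Definition encode_sparse (l : seq (R * nat)) : value R :=
  vlist [seq VCons (VReal u.1) (VNat u.2) | u <- l].

Definition encode_input (k m : nat) (l : 'I_m -> seq (R * nat))
    (alpha : 'I_k -> 'I_m -> nat) : value R :=
  VCons (vlist [seq encode_sparse (l j) | j <- enum 'I_m])
        (vlist [seq vlist [seq VNat (alpha i j) | j <- enum 'I_m]
               | i <- enum 'I_k]).

End Semantics.

(* Main.v *)
(* Rolle's theorem applied to the quotient of [phi] by one of its terms
   [g_1 T_1], with [T_i = prod_j f_j ^ alpha_ij], bounds the positive roots of
   [phi] by those of [g_1 T_1] and of a Wronskian.  Since [T_i' / T_i] has
   denominator [prod_j f_j], that Wronskian is, up to the factors [T_1] and
   [prod_j f_j], a sum [sum_(i >= 2) h_i T_i] with sparse [h_i].  Iterating, a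
   non-zero [phi] has at most polynomially many positive roots in the number of
   monomials of the [f_j], whatever the exponents [alpha_ij].  It thus suffices
   to evaluate [phi] at the points 1, ..., N for a polynomially large N, which
   real arithmetic of unit cost does in polynomial time by repeated squaring. *)

From HB Require Import structures.
From mathcomp Require Import all_boot all_order all_algebra.
From mathcomp Require Import reals.
From mathcomp Require Import boolp topology normedtype derive realfun.
From mathcomp Require Import ring zify.
Require Import Defs.

Import Order.TTheory GRing.Theory Num.Theory.
Import numFieldNormedType.Exports.
Local Open Scope ring_scope.

(** * Positive roots and Wronskians *)

Section PositiveRoots.
Variable R : realType.
Implicit Types (p q F G : {poly R}) (s : seq R).

(** Roots are counted without multiplicity, so that raising a factor to a power costs nothing. For
    [p = 0] the property fails for every [n]. *)
Definition posroots_le p (n : nat) : Prop :=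
  forall s, uniq s -> {in s, forall x, 0 < x} -> {in s, forall x, root p x} ->
    (size s <= n)%N.

Lemma posroots_le_sub p q n :
  (forall x, 0 < x -> root p x -> root q x) -> posroots_le q n ->
  posroots_le p n.
Proof.
move=> pq hq s us s0 sp; apply: hq => // x xs; apply: pq; [exact: s0|exact: sp].
Qed.

Lemma posroots_leW p m n : (m <= n)%N -> posroots_le p m -> posroots_le p n.
Proof. by move=> mn pm s us s0 sp; apply: leq_trans mn; exact: pm. Qed.

Lemma posroots_leM p q m n :
  posroots_le p m -> posroots_le q n -> posroots_le (p * q) (m + n).
Proof.
move=> pm qn s us s0 spq; rewrite -(count_predC (root p) s) -!size_filter.
apply: leq_add; [apply: pm|apply: qn]; rewrite ?filter_uniq // => x;
  rewrite mem_filter => /andP[xp xs] //; first exact: s0.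
  exact: s0.
by move: (spq _ xs); rewrite rootM (negbTE xp).
Qed.

(** Rolle's theorem is applied to [F / G], whose derivative is the Wronskian divided by [G ^+ 2]. *)
Lemma rolle_quotient F G (a b : R) : a < b ->
  (forall x, a <= x <= b -> G.[x] != 0) -> F.[a] = 0 -> F.[b] = 0 ->
  exists2 c, a < c < b & root (F^`() * G - F * G^`()) c.
Proof.
move=> ab G0 Fa Fb.
pose h (x : R) : R := F.[x] * (G.[x])^-1.
have dh x : G.[x] != 0 ->
    is_derive x 1 h (F.[x] * (- (G.[x]) ^- 2 * G^`().[x]) + (G.[x])^-1 * F^`().[x]).
  move=> Gx.
  have dV := @is_deriveV R (horner G) x _ 1 Gx (is_derive_poly G x).
  exact: (@is_deriveM R R (horner F) (fun y => (G.[y])^-1) x 1 _ _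
    (is_derive_poly F x) dV).
have [|||c cab hc] := @Rolle R h a b ab.
- move=> x; rewrite in_itv /= => /andP[/ltW ax /ltW xb].
  by have [] := dh x (G0 x _); rewrite ?ax.
- apply: derivable_within_continuous => x; rewrite in_itv /= => xab.
  by have [] := dh x (G0 x xab).
- by rewrite /h Fa Fb !mul0r.
move: cab; rewrite in_itv /= => cab; exists c => //.
have Gc : G.[c] != 0 by apply: G0; case/andP: cab => /ltW -> /ltW ->.
have [_ e1] := dh c Gc; have [_ e2] := hc.
move: e1; rewrite e2 => e1; rewrite rootE !hornerE.
have -> : F^`().[c] * G.[c] - F.[c] * G^`().[c] = G.[c] ^+ 2 *
   (F.[c] * (- G.[c] ^- 2 * G^`().[c]) + G.[c]^-1 * F^`().[c]) by field.
by rewrite -e1 mulr0.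
Qed.

(** One point is picked in each gap between neighbours. The gaps are disjoint and ordered, so the
    points increase; all of them exceed [a], which later gives their positivity. *)
Lemma interlacing_seq (P : R -> Prop) (a : R) s :
  (forall x y, x \in a :: s -> y \in a :: s -> x < y ->
     exists2 c, x < c < y & P c) ->
  path <%R a s ->
  exists s', [/\ path <%R a s', size s' = size s & {in s', forall x, P x}].
Proof.
elim: s a => [|b s IH] a between; first by exists [::].
move=> /= /andP[ab bs].
have [|s' [ps' ss' Ps']] := IH b _ bs.
  by move=> x y xs ys; apply: between; rewrite inE ?xs ?ys orbT.
have [||c /andP[ac cb] Pc] := between a b _ _ ab; rewrite ?inE ?eqxx ?orbT //.
exists (c :: s'); split => //=; last first.
- by move=> x; rewrite inE => /orP[/eqP->|/Ps'].
- by rewrite ss'.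
- rewrite ac /=; case: s' ps' {ss' Ps'} => //= d s' /andP[bd ->].
  by rewrite (lt_trans cb bd).
Qed.

(** For positive degrees, the leading coefficients of the two sides are [lead_coef F * lead_coef G]
    times the degree of [F] and of [G] respectively; characteristic zero then equates the degrees.
    If one polynomial is constant, the identity makes the other derivative vanish too. *)
Lemma size_wronskian0 F G : F != 0 -> G != 0 ->
  F^`() * G = F * G^`() -> size F = size G.
Proof.
have lcd (p : {poly R}) : (1 < size p)%N ->
    lead_coef p^`() = lead_coef p *+ (size p).-1 /\ size p^`() = (size p).-1.
  move=> p1; have sd : size p^`() = (size p).-1.
    rewrite /deriv size_poly_eq // prednK; last lia.
    rewrite mulrn_eq0 -lead_coefE lead_coef_eq0 -size_poly_eq0.
    by case: (size p) p1 => [|[]].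
  split => //; rewrite !lead_coefE sd coef_deriv.
  by have -> : (size p).-1.-1.+1 = (size p).-1 by lia.
have const (p : {poly R}) : (p^`() == 0) = (size p <= 1)%N.
  apply/eqP/idP => [d0|/size1_polyC->]; last by rewrite derivC.
  rewrite leqNgt; apply/negP => p1; have [_] := lcd _ p1.
  by rewrite d0 size_poly0; case: (size p) p1 => [|[]].
move=> F0 G0 e.
have sF0 : (0 < size F)%N by rewrite lt0n size_poly_eq0.
have sG0 : (0 < size G)%N by rewrite lt0n size_poly_eq0.
have [G1|F1] : (size G <= 1)%N + (1 < size G)%N by case: leqP; [left|right].
  have dG : G^`() = 0 by apply/eqP; rewrite const.
  move/eqP: e; rewrite dG mulr0 mulf_eq0 (negbTE G0) orbF const; lia.
have [F1'|F1'] : (size F <= 1)%N + (1 < size F)%N by case: leqP; [left|right].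
  have dF : F^`() = 0 by apply/eqP; rewrite const.
  move/esym/eqP: e; rewrite dF mul0r mulf_eq0 (negbTE F0) const; lia.
move/(congr1 lead_coef): e; rewrite !lead_coefM (lcd _ F1).1 (lcd _ F1').1.
rewrite mulrnAl mulrnAr => /eqP; rewrite -subr_eq0.
rewrite -!(mulr_natr (lead_coef F * _)) -mulrBr mulf_eq0 mulf_eq0 !lead_coef_eq0.
rewrite (negbTE F0) (negbTE G0) /= subr_eq0 eqr_nat => /eqP e'.
by rewrite -(prednK sF0) e' prednK.
Qed.

(** Subtracting the multiple of [G] with the same leading term keeps the Wronskian with [G] zero. A
    non-zero difference would again have the size of [G], although its coefficient in that degree
    has been cancelled. *)
Lemma wronskian0_proportional F G : G != 0 ->
  F^`() * G = F * G^`() -> exists c : R, F = c *: G.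
Proof.
move=> G0 e; have [->|F0] := eqVneq F 0; first by exists 0; rewrite scale0r.
have sFG := size_wronskian0 _ _ F0 G0 e.
exists (lead_coef F / lead_coef G); set c := _ / _.
apply/eqP; rewrite -subr_eq0; apply/negPn/negP => D0.
have sDG : size (F - c *: G) = size G.
  apply: size_wronskian0 => //.
  by rewrite derivB derivZ mulrBl mulrBl e -!scalerAl [G^`() * G]mulrC.
have : lead_coef (F - c *: G) = 0.
  rewrite lead_coefE sDG coefB coefZ -{1}sFG -!lead_coefE divfK ?subrr //.
  by rewrite lead_coef_eq0.
by move/eqP; rewrite lead_coef_eq0 (negbTE D0).
Qed.

(** At most [m] roots of [F] are roots of [G]. Between two neighbours among the others lies a root
    of [G], or else Rolle applies and gives a root of the Wronskian: at most [m + n] gaps, hence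
    [m + n + 1] such roots. If the Wronskian is zero, [F] is a non-zero multiple of [G]. *)
Lemma posroots_le_wronskian F G m n : F != 0 -> G != 0 ->
  posroots_le G m ->
  (F^`() * G - F * G^`() != 0 -> posroots_le (F^`() * G - F * G^`()) n) ->
  posroots_le F (m.*2 + n).+1.
Proof.
move=> F0 G0 Gm Wn.
have [W0|/Wn{}Wn] := eqVneq (F^`() * G - F * G^`()) 0.
  have [c Fc] : exists c : R, F = c *: G.
    by apply: wronskian0_proportional => //; apply/eqP; rewrite -subr_eq0 W0.
  apply: posroots_leW (_ : (m <= _)%N) _; first lia.
  apply: posroots_le_sub Gm => x _; rewrite Fc rootZ //.
  by apply: contraNneq F0 => c0; rewrite Fc c0 scale0r.
move=> s us s0 sF; rewrite -(count_predC (root G) s) -!size_filter.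
have sG : (size [seq x <- s | root G x] <= m)%N.
  by apply: Gm; rewrite ?filter_uniq // => x; rewrite mem_filter => /andP[? /s0].
set s2 := [seq x <- s | predC (root G) x].
suff s2mn : (size s2 <= (m + n).+1)%N.
  by apply: leq_trans (leq_add sG s2mn) _; lia.
have := sort_lt_sorted s2; rewrite filter_uniq //.
have := mem_sort <=%O s2.
rewrite -(size_sort <=%O); case: sort => [//|a r] memr /= srt.
have rP x : x \in a :: r -> [/\ 0 < x, root F x & ~~ root G x].
  by rewrite memr mem_filter => /andP[/= xG xs]; split; [exact: s0|exact: sF|].
(* Both kinds of intermediate point are roots of the product of [G] and the Wronskian, so that a
   single count covers them. *)
have [|r' [pr' <- Pr']] := interlacing_seq
  (fun c => root (G * (F^`() * G - F * G^`())) c) a r _ srt.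
  move=> x y /rP[x0 xF xG] /rP[y0 yF yG] xy.
  have [[c [cx cy cG]]|noG] : (exists c, [/\ x < c, c < y & root G c]) \/
     (forall c, x < c < y -> ~~ root G c).
    have [?|no] := pselect (exists c, [/\ x < c, c < y & root G c]); [by left|right].
    by move=> c /andP[xc cy]; apply/negP => cG; apply: no; exists c.
  - by exists c; rewrite ?cx // rootM cG.
  have [|||c cxy cW] := rolle_quotient F G x y xy.
  - move=> z; rewrite !le_eqVlt => /andP[/orP[/eqP<- //|xz] /orP[/eqP-> //|zy]].
    by apply: noG; rewrite xz.
  - exact/eqP.
  - exact/eqP.
  by exists c => //; rewrite rootM cW orbT.
rewrite ltnS; apply: (posroots_leM _ _ _ _ Gm Wn) => //.
  by move: (path_sorted pr') => /lt_sorted_uniq.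
have [a0 _ _] := rP a (mem_head _ _).
move=> x xr'; apply: lt_trans a0 _.
by move: pr' => /(order_path_min lt_trans)/allP/(_ _ xr').
Qed.

End PositiveRoots.

(** * Sums of products of powers of sparse polynomials *)

(** The recursion follows [posroots_le_wronskian] with [G = g_0 T_0], where [s] bounds the number of
    terms of the coefficients [g_i]: [s + m * t] counts the roots of [G], the next [m * t] those of
    the factor [T_0] of the Wronskian. The summand [s] in the new sparsity keeps it at least [s],
    for the case [g_0 = 0]. *)
Fixpoint root_bound (m t k s : nat) : nat :=
  if k is k'.+1 then
    ((s + m * t).*2 + (m * t + root_bound m t k' (s + (m.+1 * t ^ m * s ^ 2).*2))).+1
  else 0.

Section SparseRoots.
Variable R : realType.
Implicit Types (p q g F G : {poly R}) (l : seq (R * nat)).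

(* Repeated exponents are allowed, so that sums and products of sparse
   polynomials need no normalization. *)
Definition sparse (n : nat) p : Prop :=
  exists2 l, (size l <= n)%N & p = \sum_(u <- l) u.1 *: 'X^(u.2).

Lemma sparseW m n p : (m <= n)%N -> sparse m p -> sparse n p.
Proof. by move=> mn [l lm ->]; exists l => //; apply: leq_trans mn. Qed.

Lemma sparse1 : sparse 1 1.
Proof. by exists [:: (1, 0%N)] => //; rewrite big_seq1 scale1r expr0. Qed.

Lemma sparseD m n p q : sparse m p -> sparse n q -> sparse (m + n) (p + q).
Proof.
move=> [l lm ->] [l' ln ->]; exists (l ++ l'); last by rewrite big_cat.
by rewrite size_cat leq_add.
Qed.

Lemma sparse_map n p (h : R * nat -> R * nat) (H : {poly R} -> {poly R}) :
  {morph H : x y / x + y} -> H 0 = 0 ->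
  (forall c e, H (c *: 'X^e) = (h (c, e)).1 *: 'X^((h (c, e)).2)) ->
  sparse n p -> sparse n (H p).
Proof.
move=> HD H0 Hh [l ln ->]; exists (map h l); first by rewrite size_map.
by rewrite big_map (big_morph H HD H0); apply: eq_bigr => -[c e] _; exact: Hh.
Qed.

Lemma sparseN n p : sparse n p -> sparse n (- p).
Proof.
apply: (@sparse_map _ _ (fun u => (- u.1, u.2)) -%R); last 1 first.
- by move=> c e; rewrite scaleNr.
- exact: opprD.
- exact: oppr0.
Qed.

Lemma sparseB m n p q : sparse m p -> sparse n q -> sparse (m + n) (p - q).
Proof. by move=> ? ?; apply: sparseD => //; exact: sparseN. Qed.

Lemma sparseMn k n p : sparse n p -> sparse n (p *+ k).
Proof.
apply: (@sparse_map _ _ (fun u => (u.1 *+ k, u.2)) (fun p => p *+ k)).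
- by move=> x y /=; rewrite mulrnDl.
- exact: mul0rn.
- by move=> c e; rewrite scalerMnl.
Qed.

Lemma sparse_deriv n p : sparse n p -> sparse n p^`().
Proof.
apply: (@sparse_map _ _ (fun u => (u.1 *+ u.2, u.2.-1)) (@deriv _)).
- exact: derivD.
- exact: deriv0.
- by move=> c e; rewrite derivZ derivXn /= -scalerMnr scalerMnl.
Qed.

Lemma sparseM m n p q : sparse m p -> sparse n q -> sparse (m * n) (p * q).
Proof.
move=> [l lm ->] [l' ln ->].
exists [seq (u.1 * v.1, (u.2 + v.2)%N) | u <- l, v <- l'].
  by rewrite size_allpairs leq_mul.
rewrite big_allpairs_dep mulr_suml; apply: eq_bigr => u _.
rewrite mulr_sumr; apply: eq_bigr => v _ /=.
by rewrite -scalerAl -scalerAr scalerA exprD.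
Qed.

(** A weak form of Descartes' rule, by induction on the number of terms: the Wronskian with one
    monomial ['X^a], which has no positive root, removes that term. *)
Lemma sparse_posroots n p : sparse n p -> p != 0 -> posroots_le R p n.
Proof.
elim: n p => [|n IH] p [l ln pE] p0.
  by case: l ln pE p0 => // _ ->; rewrite big_nil eqxx.
case: l ln pE => [_ pE|[c a] l ln pE]; first by rewrite pE big_nil eqxx in p0.
have Xa0 : 'X^a != 0 :> {poly R} by rewrite monic_neq0 ?monicXn.
have Xpos : posroots_le R 'X^a 0.
  move=> s _ s0 sr; case: s s0 sr => // x s s0 sr.
  have x0 := s0 x (mem_head _ _); have := sr x (mem_head _ _).
  by rewrite rootE hornerXn expf_eq0 (gt_eqF x0) andbF.
apply: (posroots_le_wronskian R p 'X^a 0 n p0 Xa0 Xpos).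
(* The operator multiplies ['X^e] by [e - a], hence kills ['X^a] and creates no new exponent. *)
pose V := 'X * p^`() - p *+ a.
have VE : V = \sum_(u <- l) (u.1 * (u.2%:R - a%:R)) *: 'X^(u.2).
  rewrite /V pE raddf_sum mulr_sumr -sumrMnl -sumrB big_cons /=.
  have E (b : R) e : 'X * (b *: 'X^e)^`() - (b *: 'X^e) *+ a =
      (b * (e%:R - a%:R)) *: 'X^e.
    rewrite derivZ derivXn -scalerAr mulrnAr -scalerMnr !scalerMnl.
    rewrite -!(mulr_natr b) mulrBr scalerBl; congr (_ - _).
    by case: e => [|e]; rewrite ?mulr0 ?scale0r // -exprS.
  by rewrite E subrr mulr0 scale0r add0r; apply: eq_bigr => u _; rewrite E.
(* The extra factor ['X] avoids the exponent [a - 1], which is truncated at [a = 0]. *)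
have XW : 'X * (p^`() * 'X^a - p * ('X^a)^`()) = 'X^a * V.
  rewrite /V derivXn !mulrBr.
  congr (_ - _); first by ring.
  rewrite !mulrnAr.
  case: a {VE V pE ln Xa0 Xpos} => [|a]; rewrite ?mulr0n // exprS.
  by congr (_ *+ _); ring.
move=> W0; apply: (@posroots_le_sub _ _ V).
  move=> x x0 xW; have : root ('X * (p^`() * 'X^a - p * ('X^a)^`())) x.
    by rewrite rootM xW orbT.
  rewrite XW rootM => /orP[|//]; rewrite rootE hornerXn expf_eq0.
  by rewrite (gt_eqF x0) andbF.
apply: IH; last first.
  by apply: contraNneq W0 => V0; move/eqP: XW; rewrite V0 mulr0 mulf_eq0 polyX_eq0.
exists [seq (u.1 * (u.2%:R - a%:R), u.2) | u <- l]; first by rewrite size_map.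
by rewrite big_map.
Qed.

(** * Products of powers and the elimination of one term at a time *)

Variables (m : nat) (f : 'I_m -> {poly R}) (t : nat).
Hypothesis f_neq0 : forall j, f j != 0.
Hypothesis f_sparse : forall j, sparse t (f j).

Definition powprod (a : 'I_m -> nat) : {poly R} := \prod_(j < m) f j ^+ a j.

Lemma powprod_neq0 a : powprod a != 0.
Proof. by apply/prodf_neq0 => j _; rewrite expf_neq0. Qed.

Lemma prod_sparse (r : seq 'I_m) : sparse (t ^ size r) (\prod_(j <- r) f j).
Proof.
elim: r => [|j r IH]; first by rewrite big_nil; exact: sparse1.
by rewrite big_cons /= expnS; exact: sparseM.
Qed.

(** A power has no root that its base lacks, so the exponents do not enter the bound. *)
Lemma powprod_seq_posroots (a : 'I_m -> nat) (r : seq 'I_m) :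
  posroots_le R (\prod_(j <- r) f j ^+ a j) (size r * t).
Proof.
elim: r => [|j r IH].
  rewrite big_nil => -[//|x s] _ _ /(_ x (mem_head _ _)).
  by rewrite rootE hornerC oner_eq0.
rewrite big_cons /= mulSn; apply: posroots_leM => //.
apply: (@posroots_le_sub _ _ (f j)); last exact: sparse_posroots.
by move=> x _; rewrite !rootE horner_exp expf_eq0 => /andP[].
Qed.

(** [D] is the numerator of the logarithmic derivative, the sum of the [a j * f_j' / f_j], over the
    common denominator [\prod f_j]. The exponents occur in it only as scalars, so its sparsity does
    not depend on them. *)
Lemma deriv_powprod (a : 'I_m -> nat) (r : seq 'I_m) :
  exists2 D, sparse (size r * t ^ size r) D &
    (\prod_(j <- r) f j ^+ a j)^`() * \prod_(j <- r) f j =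
    (\prod_(j <- r) f j ^+ a j) * D.
Proof.
elim: r => [|j r [D Ds DE]].
  by exists 0; [exists [::] => //; rewrite big_nil|rewrite !big_nil derivC mul0r mulr0].
exists ((f j)^`() *+ a j * \prod_(j <- r) f j + f j * D).
  rewrite /= mulSn expnS; apply: sparseD.
    apply: sparseM (prod_sparse r); exact/sparseMn/sparse_deriv.
  by rewrite mulnCA; exact: sparseM.
rewrite !big_cons derivM deriv_exp mulrDl.
set T := \prod_(j <- r) _ ^+ _ in DE *; set Q := \prod_(j <- r) f j in DE *.
have -> : f j ^+ a j * T^`() * (f j * Q) = f j ^+ a j * f j * (T^`() * Q) by ring.
rewrite DE mulrDr; congr (_ + _); last by ring.
(* The derivative of the power has exponent [(a j).-1], so a zero exponent is treated apart; the
   scalar [a j] then kills both sides. *)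
case: (a j) => [|b]; first by rewrite !mulr0n !mul0r mulr0.
by rewrite !(mulrnAl, mulrnAr) /=; congr (_ *+ _); rewrite exprS; ring.
Qed.

(** Induction on the number of terms needs arbitrary sparse coefficients [g], since the Wronskian
    with the first term turns even constant coefficients into non-constant ones. *)
Lemma sum_powprod_posroots (k s : nat) (g : 'I_k -> {poly R})
    (alpha : 'I_k -> 'I_m -> nat) :
  (forall i, sparse s (g i)) ->
  \sum_(i < k) g i * powprod (alpha i) != 0 ->
  posroots_le R (\sum_(i < k) g i * powprod (alpha i)) (root_bound m t k s).
Proof.
have size_r : size (index_enum 'I_m) = m.
  by rewrite -sum1_size sum1_card card_ord.
elim: k s g alpha => [|k IH] s g alpha gs.
  by rewrite big_ord0 eqxx.
rewrite big_ord_recl; set g0 := g ord0; set T0 := powprod (alpha ord0).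
set F1 := (X in _ + X) => F0.
pose s' := (s + (m.+1 * t ^ m * s ^ 2).*2)%N.
(* A zero coefficient already leaves one term fewer; the induction hypothesis is used at the larger
   sparsity [s'] to match [root_bound]. *)
have [g00|g0_neq0] := eqVneq g0 0.
  rewrite g00 mul0r add0r in F0 *.
  apply: posroots_leW (IH s' _ _ _ F0).
    by rewrite /= -/s'; lia.
  by move=> i; apply: sparseW (gs _); rewrite /s'; lia.
have G0 : g0 * T0 != 0 by rewrite mulf_neq0 // powprod_neq0.
have T0_pr : posroots_le R T0 (m * t).
  by have := powprod_seq_posroots (alpha ord0) (index_enum 'I_m); rewrite size_r.
have G_pr : posroots_le R (g0 * T0) (s + m * t).
  by apply: posroots_leM T0_pr; exact: (sparse_posroots _ _ (gs ord0)).
apply: (posroots_le_wronskian _ _ _ _ _ F0 G0 G_pr).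
pose Q := \prod_(j < m) f j.
have Q0 : Q != 0 by apply/prodf_neq0 => j _.
have Qs : sparse (t ^ m) Q.
  by have := prod_sparse (index_enum 'I_m); rewrite size_r.
have hD (i : 'I_k.+1) : exists2 D, sparse (m * t ^ m) D &
    (powprod (alpha i))^`() * Q = powprod (alpha i) * D.
  by have := deriv_powprod (alpha i) (index_enum 'I_m); rewrite size_r.
have [D Ds DE] := fin_all_exists2 hD.
(* Up to the denominator [Q], differentiating a term replaces its coefficient [g i] by [L i] and
   leaves the product of powers alone. *)
pose L i := (g i)^`() * Q + g i * D i.
have Ls i : sparse (m.+1 * t ^ m * s) (L i).
  rewrite mulSn mulnDl; apply: sparseD.
    by rewrite mulnC; apply: sparseM => //; exact: sparse_deriv.
  by rewrite mulnC; exact: sparseM.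
have LE i : (g i * powprod (alpha i))^`() * Q = powprod (alpha i) * L i.
  rewrite derivM mulrDl -[g i * _ * Q]mulrA DE /L; ring.
pose h (i : 'I_k) := L (lift ord0 i) * g0 - g (lift ord0 i) * L ord0.
have hs i : sparse s' (h i).
  apply: (@sparseW (m.+1 * t ^ m * s * s + s * (m.+1 * t ^ m * s))).
    by rewrite /s'; nia.
  by apply: sparseB; apply: sparseM => //; exact: gs.
set W := (X in X != 0).
have QW : Q * W = T0 * \sum_(i < k) h i * powprod (alpha (lift ord0 i)).
  (* The first term has zero Wronskian with itself, so only the tail [F1] contributes. *)
  have -> : W = F1^`() * (g0 * T0) - F1 * (g0 * T0)^`().
    by rewrite /W derivD; ring.
  rewrite /F1 raddf_sum /=.
  rewrite !mulr_suml -sumrB !mulr_sumr; apply: eq_bigr => i _.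
  have -> (A B C E : {poly R}) : Q * (A * B - C * E) = (A * Q) * B - C * (E * Q).
    by ring.
  by rewrite !LE /h /g0 /T0; ring.
move=> W0; apply: (@posroots_le_sub _ _
  (T0 * \sum_(i < k) h i * powprod (alpha (lift ord0 i)))).
  by move=> x _ xW; rewrite -QW rootM xW orbT.
apply: posroots_leM => //; apply: IH => //.
have : Q * W != 0 by rewrite mulf_neq0.
by rewrite QW mulf_eq0 negb_or => /andP[].
Qed.

(** The points 1, ..., [N] are distinct and positive, and exceed in number the roots of a non-zero
    sum. The constant coefficients 1 have one term, hence the last argument of [root_bound]. *)
Lemma sum_powprod_eq0 (k N : nat) (alpha : 'I_k -> 'I_m -> nat) :
  (root_bound m t k 1 < N)%N ->
  (forall n, (0 < n <= N)%N -> root (\sum_(i < k) powprod (alpha i)) n%:R) ->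
  \sum_(i < k) powprod (alpha i) = 0.
Proof.
move=> zN phi0; apply/eqP/negPn/negP => phi_neq0.
have phiE : \sum_(i < k) powprod (alpha i) =
    \sum_(i < k) (fun=> 1 : {poly R}) i * powprod (alpha i).
  by apply: eq_bigr => i _; rewrite mul1r.
have := @sum_powprod_posroots k 1 (fun=> 1) alpha (fun=> sparse1).
rewrite -phiE => /(_ phi_neq0 [seq i%:R | i <- iota 1 N]).
rewrite size_map size_iota leqNgt zN => h; suff: false by []; apply: h.
- rewrite map_inj_uniq ?iota_uniq // => i j /eqP; rewrite eqr_nat => /eqP; exact.
- by move=> x /mapP[i]; rewrite mem_iota => /andP[i0 _] ->; rewrite ltr0n.
- move=> x /mapP[i]; rewrite mem_iota => /andP[i0 iN] ->; apply: phi0.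
  by rewrite i0 -ltnS.
Qed.

End SparseRoots.

(** * Execution within a cost bound *)

Fixpoint assigned (c : cmd) : seq nat :=
  match c with
  | CSkip => [::]
  | CAssign x _ => [:: x]
  | CSeq c1 c2 => assigned c1 ++ assigned c2
  | CIf _ c1 c2 => assigned c1 ++ assigned c2
  | CWhile _ c1 => assigned c1
  end.

Section Logic.
Variable R : realType.
Implicit Types (s : store R) (Q : store R -> Prop).

Lemma exec_frame c s n s' : exec c s n s' ->
  forall x, x \notin assigned c -> s' x = s x.
Proof.
elim=> {c s n s'} /=.
- by [].
- by move=> s x e y; rewrite inE /upd => /negbTE ->.
- move=> c1 c2 s n1 s1 n2 s2 _ IH1 _ IH2 x.
  by rewrite mem_cat negb_or => /andP[x1 x2]; rewrite IH2 ?IH1.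
- move=> e c1 c2 s n s' _ IH x; rewrite mem_cat negb_or => /andP[x1 x2].
  by apply: IH; case: truth.
- by [].
- by move=> e c s n1 s1 n2 s2 _ _ IH1 _ IH2 x xc; rewrite IH2 ?IH1.
Qed.

(** A total-correctness Hoare triple with a cost budget. *)
Definition texec c s (B : nat) Q : Prop :=
  exists n s', [/\ exec c s n s', (n <= B)%N & Q s'].

(** The rules of consequence and of framing in one: a specification need only mention the variable
    it computes. *)
Lemma texec_conseq c s B B' Q Q' : (B <= B')%N ->
  (forall s', Q s' -> (forall x, x \notin assigned c -> s' x = s x) -> Q' s') ->
  texec c s B Q -> texec c s B' Q'.
Proof.
move=> BB' QQ' [n [s' [ex nB Qs']]]; exists n, s'; split => //.
  exact: leq_trans BB'.
by apply: QQ' => //; exact: exec_frame ex.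
Qed.

Lemma texec_skip s B Q : (0 < B)%N -> Q s -> texec CSkip s B Q.
Proof. by move=> B0 Qs; exists 1%N, s; split => //; constructor. Qed.

Lemma texec_assign s x e B Q : (ecost s e < B)%N ->
  Q (upd s x (eval s e)) -> texec (CAssign x e) s B Q.
Proof. by move=> cB Qs; do 2 eexists; split; [constructor|exact: cB|exact: Qs]. Qed.

Lemma texec_seq B1 B2 B c1 c2 s Q : (B1 + B2 < B)%N ->
  texec c1 s B1 (fun s1 => texec c2 s1 B2 Q) -> texec (CSeq c1 c2) s B Q.
Proof.
move=> BB [n1 [s1 [ex1 n1B [n2 [s2 [ex2 n2B Qs]]]]]].
exists (n1 + n2).+1, s2; split => //; first exact: exec_seq ex1 ex2.
by apply: leq_trans BB; rewrite ltnS leq_add.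
Qed.

Lemma texec_if B' B e c1 c2 s Q : (ecost s e + B' < B)%N ->
  texec (if truth (eval s e) then c1 else c2) s B' Q -> texec (CIf e c1 c2) s B Q.
Proof.
move=> BB [n [s' [ex nB Qs]]]; exists (ecost s e + n).+1, s'; split => //.
  exact: exec_if.
by apply: leq_trans BB; rewrite ltnS leq_add2l.
Qed.

(* [I r s]: at most [r] iterations remain. *)
Lemma texec_while (I : nat -> store R -> Prop) (E C r B : nat) e c s Q :
  I r s ->
  (forall r s, I r s -> ecost s e <= E)%N ->
  (forall r s, I r s -> truth (eval s e) = false -> Q s) ->
  (forall r s, I r s -> truth (eval s e) = true ->
     exists2 r', r = r'.+1 & texec c s C (I r')) ->
  (r * (E + C + 1) + E < B)%N ->
  texec (CWhile e c) s B Q.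
Proof.
move=> Is hE hQ hI; elim: r s B Is => [|r IH] s B Is hB.
- have [t|t] := boolP (truth (eval s e)); first by have [] := hI _ _ Is t.
  exists (ecost s e).+1, s; split; first by constructor; apply/negbTE.
    by apply: leq_ltn_trans (hE _ _ Is) _; move: hB; lia.
  by apply: hQ Is _; apply/negbTE.
- have [t|t] := boolP (truth (eval s e)).
    have [r' [<-] [n1 [s1 [ex1 n1C Is1]]]] := hI _ _ Is t.
    have [||n2 [s2 [ex2 n2B Qs2]]] := IH s1 (r * (E + C + 1) + E).+1; rewrite ?Is1 //.
    exists (ecost s e + n1 + n2).+1, s2; split => //.
      exact: exec_while_true ex1 ex2.
    by have := hE _ _ Is; move: hB n1C n2B; lia.
  exists (ecost s e).+1, s; split; first by constructor; apply/negbTE.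
    by apply: leq_ltn_trans (hE _ _ Is) _; move: hB; lia.
  by apply: hQ Is _; apply/negbTE.
Qed.

Lemma leq_bitlen m n : (m <= n)%N -> (bitlen m <= bitlen n)%N.
Proof. by move=> mn; rewrite ltnS leq_trunc_log. Qed.

Lemma bitlen_leS n : (bitlen n <= n.+1)%N.
Proof.
rewrite /bitlen; case: n => [|n]; first by rewrite trunc_log0.
rewrite ltnS; apply: leq_trans (trunc_logP (leqnn 2) (ltn0Sn n)).
exact/ltnW/ltn_expl.
Qed.

Lemma ltn_exp2_bitlen n : (n < 2 ^ bitlen n)%N.
Proof. exact: trunc_log_ltn. Qed.

End Logic.

(** * The identity test *)

Local Notation xPolys := 1%N.
Local Notation xMonos := 2%N.
Local Notation xCount := 3%N.
Local Notation xPoint := 4%N.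
Local Notation xReal := 5%N.
Local Notation xSum := 6%N.
Local Notation xRows := 7%N.
Local Notation xProd := 8%N.
Local Notation xRow := 9%N.
Local Notation xVal := 10%N.
Local Notation xExp := 11%N.
Local Notation xTerm := 12%N.
Local Notation xBase := 13%N.
Local Notation xAlpha := 14%N.
Local Notation xAnswer := 15%N.

Local Notation "x ::= e" := (CAssign x e) (at level 80, e at level 70).
Local Notation "c1 ;; c2" := (CSeq c1 c2) (at level 90, right associativity).

Definition zeroE := ENatToReal (ENat 0).
Definition oneE := ENatToReal (ENat 1).

(** Binary exponentiation from the lowest bit. The language has no remainder, so the parity of [e]
    is obtained as [e - e %/ 2 * 2]. *)
Definition power_loop : cmd :=
  CWhile (ENatLe (ENat 1) (EVar xExp))
   (CIf (ENatLe (ENat 1) (ENatOp NSub (EVar xExp)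
          (ENatOp NMul (ENatOp NDiv (EVar xExp) (ENat 2)) (ENat 2))))
      (xTerm ::= ERealOp RMul (EVar xTerm) (EVar xBase)) CSkip ;;
    xBase ::= ERealOp RMul (EVar xBase) (EVar xBase) ;;
    xExp ::= ENatOp NDiv (EVar xExp) (ENat 2)).

(** [xTerm] starts at the coefficient instead of 1, so that [power_loop] delivers the whole
    monomial. *)
Definition monomial_loop : cmd :=
  CWhile (EVar xMonos)
   (xExp ::= ETl (EHd (EVar xMonos)) ;;
    xTerm ::= EHd (EHd (EVar xMonos)) ;;
    xBase ::= EVar xReal ;;
    xMonos ::= ETl (EVar xMonos) ;;
    power_loop ;;
    xVal ::= ERealOp RAdd (EVar xVal) (EVar xTerm)).

(** Repeated multiplication suffices here, as the running time may depend on the values of the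
    [alpha]; the exponents of the monomials count only by their bit length and need [power_loop]. *)
Definition alpha_loop : cmd :=
  CWhile (ENatLe (ENat 1) (EVar xAlpha))
   (xProd ::= ERealOp RMul (EVar xProd) (EVar xVal) ;;
    xAlpha ::= ENatOp NSub (EVar xAlpha) (ENat 1)).

Definition product_loop : cmd :=
  CWhile (EVar xPolys)
   (xMonos ::= EHd (EVar xPolys) ;;
    xPolys ::= ETl (EVar xPolys) ;;
    xVal ::= zeroE ;;
    xAlpha ::= EHd (EVar xRow) ;;
    xRow ::= ETl (EVar xRow) ;;
    monomial_loop ;;
    alpha_loop).

Definition sum_loop : cmd :=
  CWhile (EVar xRows)
   (xProd ::= oneE ;;
    xPolys ::= EHd (EVar 0) ;;
    xRow ::= EHd (EVar xRows) ;;
    xRows ::= ETl (EVar xRows) ;;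
    product_loop ;;
    xSum ::= ERealOp RAdd (EVar xSum) (EVar xProd)).

(** Equality with zero is tested by two comparisons. The answer starts as true and is erased at the
    first non-zero value; the points run from the last down to 1. *)
Definition point_loop : cmd :=
  CWhile (ENatLe (ENat 1) (EVar xPoint))
   (xReal ::= ENatToReal (EVar xPoint) ;;
    xSum ::= zeroE ;;
    xRows ::= ETl (EVar 0) ;;
    sum_loop ;;
    CIf (ERealLe (EVar xSum) zeroE)
      (CIf (ERealLe zeroE (EVar xSum)) CSkip (xAnswer ::= ENil))
      (xAnswer ::= ENil) ;;
    xPoint ::= ENatOp NSub (EVar xPoint) (ENat 1)).

Definition count_monomials_loop : cmd :=
  CWhile (EVar xMonos)
   (xCount ::= ENatOp NAdd (EVar xCount) (ENat 1) ;;
    xMonos ::= ETl (EVar xMonos)).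

(** The sparsity [t] is not part of the encoded input. The total number of monomials bounds the
    sparsity of each polynomial and takes its place. *)
Definition count_loop : cmd :=
  CWhile (EVar xPolys)
   (xMonos ::= EHd (EVar xPolys) ;;
    xPolys ::= ETl (EVar xPolys) ;;
    count_monomials_loop).

Definition pit_program (points : expr) : cmd :=
  xCount ::= ENat 0 ;;
  xPolys ::= EHd (EVar 0) ;;
  count_loop ;;
  xPoint ::= points ;;
  xAnswer ::= ECons ENil ENil ;;
  point_loop ;;
  0%N ::= EVar xAnswer.

(* [K] bounds the list lengths, the bit lengths and the loop counters; the
   numerical constants in the cost bounds are crude. *)
Section Correctness.
Variables (R : realType) (K : nat).
Hypothesis K_gt0 : (0 < K)%N.
Implicit Types (s : store R) (Q : store R -> Prop).

Lemma texec_assign_seq B' B s x e c Q : (ecost s e + B'.+1 < B)%N ->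
  texec R c (upd s x (eval s e)) B' Q -> texec R (x ::= e ;; c) s B Q.
Proof.
move=> hB h; apply: (texec_seq _ (ecost s e).+1 B'); first by move: hB; lia.
exact: texec_assign.
Qed.

Lemma bitlen1 : bitlen 1 = 1%N. Proof. by []. Qed.
Lemma bitlen2 : bitlen 2 = 2%N. Proof. by []. Qed.

Lemma power_loop_spec s (e : nat) (c b : R) :
  s xExp = VNat e -> s xTerm = VReal c -> s xBase = VReal b -> (bitlen e <= K)%N ->
  texec R power_loop s (80 * K ^ 2) (fun s' => s' xTerm = VReal (c * b ^+ e)).
Proof.
move=> se sc sb eK.
(* The iterations left are bounded by the bits left in the exponent, via [e' < 2 ^ r]; [r = K] is
   enough at the start. *)
pose I r s := exists e' c' b', [/\ s xExp = VNat e', s xTerm = VReal c',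
  s xBase = VReal b', (bitlen e' <= K)%N & (e' < 2 ^ r)%N /\ c * b ^+ e = c' * b' ^+ e'].
apply: (@texec_while _ I (5 * K) (60 * K) K).
- exists e, c, b; split => //; split => //.
  by apply: leq_trans (ltn_exp2_bitlen e) _; rewrite leq_exp2l.
- by move=> r s1 [e' [c' [b' [s1e _ _ ? _]]]] /=; rewrite s1e bitlen1 /=; lia.
- move=> r s1 [e' [c' [b' [s1e s1c _ _ [_ ->]]]]] /=; rewrite s1e.
  by case: e' s1e => [|e'] s1e //= _; rewrite s1c expr0 mulr1.
- move=> r s1 [e' [c' [b' [s1e s1c s1b e'K [e'r cb]]]]] /=; rewrite s1e => e'0.
  have {}e'0 : (0 < e')%N by case: e' e'0 {s1e e'K e'r cb}.
  case: r e'r => [|r] e'r; first by move: e'r e'0; rewrite expn0; case: e' {s1e e'K cb}.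
  exists r => //.
  have b1 : (bitlen (e' %/ 2) <= K)%N.
    by apply: leq_trans e'K; apply: leq_bitlen; exact: leq_div.
  have b2 : (bitlen (e' %/ 2 * 2) <= K)%N.
    by apply: leq_trans e'K; apply: leq_bitlen; exact: leq_trunc_div.
  have b3 : (bitlen (e' - e' %/ 2 * 2) <= K)%N.
    by apply: leq_trans e'K; apply: leq_bitlen; exact: leq_subr.
  apply: (texec_seq _ (40 * K) (19 * K)); first by move: K_gt0; lia.
  apply: (texec_if _ (5 * K)); first by rewrite /= s1e /= ?bitlen1 ?bitlen2; move: K_gt0; lia.
  have tail s2 c2 : s2 xExp = VNat e' -> s2 xBase = VReal b' -> s2 xTerm = VReal c2 ->
     c2 * (b' * b') ^+ (e' %/ 2) = c' * b' ^+ e' ->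
     texec R (xBase ::= ERealOp RMul (EVar xBase) (EVar xBase) ;;
        xExp ::= ENatOp NDiv (EVar xExp) (ENat 2)) s2 (19 * K) (I r).
    move=> s2e s2b s2c E.
    apply: (texec_assign_seq (10 * K)); first by rewrite /=; move: K_gt0; lia.
    apply: texec_assign; first by rewrite /upd /= s2e /= bitlen2; move: K_gt0; lia.
    exists (e' %/ 2)%N, c2, (b' * b'); rewrite /upd /= s2e s2b s2c; split => //.
    by split; [rewrite ltn_divLR // mulnC -expnS|rewrite cb E].
  have modE : (e' - e' %/ 2 * 2 = odd e')%N.
    by rewrite -modn2 {1}(divn_eq e' 2) addKn.
  (* One squaring step: the low bit is split off and the rest is a power of the square. *)
  have eE : b' ^+ e' = b' ^+ (odd e') * (b' * b') ^+ (e' %/ 2).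
    by rewrite -expr2 -exprM -exprD -modn2 addnC mulnC -divn_eq.
  rewrite /= s1e /= modE; case: (odd e') eE => /= eE.
    apply: texec_assign; first by rewrite /=; move: K_gt0; lia.
    apply: (tail _ (c' * b')); rewrite /upd /= ?s1c ?s1b ?s1e //.
    by rewrite eE expr1 mulrA.
  apply: texec_skip; first by move: K_gt0; lia.
  by apply: (tail _ c') => //; rewrite eE expr0 mul1r.
- by move: K_gt0; rewrite expnS expn1; nia.
Qed.

(** Each level of nesting raises the power of [K] by one; doubling the constant pays for the final
    guard. The budgets of the loops below are chosen in this way. *)
Lemma loop_cost r E C a n : (r <= K)%N -> (E + C + 1 <= a * K ^ n)%N ->
  (r * (E + C + 1) + E < (a + a) * K ^ n.+1)%N.
Proof.
move=> rK h; have h1 : (r * (E + C + 1) <= a * K ^ n.+1)%N.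
  by rewrite expnS mulnCA leq_mul.
have h2 : (a * K ^ n <= a * K ^ n.+1)%N by rewrite leq_mul2l leq_pexp2l ?orbT.
by move: h h1 h2; rewrite mulnDl; lia.
Qed.

Lemma K_le_exp n : (K <= K ^ n.+1)%N.
Proof. by rewrite -{1}(expn1 K) leq_pexp2l. Qed.

Definition sparse_eval (x : R) (l : seq (R * nat)) : R :=
  \sum_(u <- l) u.1 * x ^+ u.2.

Lemma monomial_loop_spec s l (x v : R) :
  s xMonos = encode_sparse l -> s xReal = VReal x -> s xVal = VReal v ->
  (size l <= K)%N -> all (fun u => bitlen u.2 <= K)%N l ->
  texec R monomial_loop s (250 * K ^ 3)
    (fun s' => s' xVal = VReal (v + sparse_eval x l)).
Proof.
move=> sl sx sv lK le.
pose I r s := exists l' v', [/\ s xMonos = encode_sparse l', s xReal = VReal x,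
  s xVal = VReal v', size l' = r &
  all (fun u => bitlen u.2 <= K)%N l' /\ v + sparse_eval x l = v' + sparse_eval x l'].
apply: (@texec_while _ I 1 (123 * K ^ 2) (size l)).
- by exists l, v.
- by [].
- move=> r s1 [[|u l'] [v' [s1l _ s1v _ [_ ->]]]]; rewrite /= s1l //= => _.
  by rewrite s1v /sparse_eval big_nil addr0.
- move=> r s1 [[|[c e] l'] [v' [s1l s1x s1v <- [le' vE]]]]; rewrite /= s1l //= => _.
  exists (size l') => //; move: le' => /= /andP[eK le'].
  have K2 := K_le_exp 1.
  apply: (texec_assign_seq (115 * K ^ 2)); first by rewrite /=; move: K_gt0 K2; lia.
  apply: (texec_assign_seq (109 * K ^ 2)); first by rewrite /=; move: K_gt0 K2; lia.
  apply: (texec_assign_seq (105 * K ^ 2)); first by rewrite /=; move: K_gt0 K2; lia.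
  apply: (texec_assign_seq (100 * K ^ 2)); first by rewrite /=; move: K_gt0 K2; lia.
  apply: (texec_seq _ (80 * K ^ 2) (10 * K ^ 2)); first by move: K_gt0 K2; lia.
  set s2 := upd _ _ _.
  have := @power_loop_spec s2 e c x; rewrite {1 2 3}/s2 /upd /= s1l s1x /=.
  move=> /(_ erefl erefl erefl eK); apply: texec_conseq => // s3 s3c fr.
  apply: texec_assign; first by rewrite /=; move: K_gt0 K2; lia.
  exists l', (v' + c * x ^+ e); rewrite /upd /= s3c !fr // /s2 /upd /= s1l s1x s1v /=.
  by split => //; split => //; rewrite vE /sparse_eval big_cons addrA.
- by apply: (@loop_cost _ _ _ 125 2) => //; move: K_gt0 (K_le_exp 1); lia.
Qed.

Lemma alpha_loop_spec s (n : nat) (p v : R) :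
  s xAlpha = VNat n -> s xProd = VReal p -> s xVal = VReal v -> (n < K)%N ->
  texec R alpha_loop s (40 * K ^ 2) (fun s' => s' xProd = VReal (p * v ^+ n)).
Proof.
move=> sn sp sv nK.
pose I r s := exists p', [/\ s xAlpha = VNat r, s xProd = VReal p',
  s xVal = VReal v & (r < K)%N /\ p * v ^+ n = p' * v ^+ r].
apply: (@texec_while _ I (5 * K) (14 * K) n).
- by exists p.
- move=> r s1 [p' [s1n _ _ [rK _]]]; rewrite /= s1n /= bitlen1.
  by move: (bitlen_leS r) rK; lia.
- move=> [|r] s1 [p' [s1n s1p _ [_ ->]]]; rewrite /= s1n //= => _.
  by rewrite s1p expr0 mulr1.
- move=> [|r] s1 [p' [s1n s1p s1v [rK pE]]]; rewrite /= s1n //= => _.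
  exists r => //; have := bitlen_leS r.+1 => br.
  apply: (texec_assign_seq (9 * K)); first by rewrite /=; move: K_gt0; lia.
  apply: texec_assign.
    by rewrite /upd /= s1n /= bitlen1; move: K_gt0 br rK; lia.
  exists (p' * v); rewrite /upd /= s1n s1p s1v /= subn1; split => //.
  by split; [exact: ltnW|rewrite pE exprS mulrA].
- by apply: (@loop_cost _ _ _ 20 1); [exact: ltnW|rewrite expn1; move: K_gt0; lia].
Qed.

Definition product_eval (x : R) (ls : seq (seq (R * nat))) (a : seq nat) : R :=
  \prod_(u <- zip ls a) sparse_eval x u.1 ^+ u.2.

Lemma product_loop_spec s (ls : seq (seq (R * nat))) (a : seq nat) (x p : R) :
  s xPolys = vlist (map (@encode_sparse R) ls) -> s xRow = vlist (map VNat a) ->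
  s xReal = VReal x -> s xProd = VReal p -> size ls = size a ->
  (size ls <= K)%N ->
  all (fun l => (size l <= K)%N && all (fun u => bitlen u.2 <= K)%N l) ls ->
  all (fun n => n < K)%N a ->
  texec R product_loop s (700 * K ^ 4)
    (fun s' => s' xProd = VReal (p * product_eval x ls a)).
Proof.
move=> sl sa sx sp la lK lsK aK.
pose I r s := exists ls' a' p',
 [/\ [/\ s xPolys = vlist (map (@encode_sparse R) ls'), s xRow = vlist (map VNat a'),
     s xReal = VReal x & s xProd = VReal p'], size ls' = size a', size ls' = r,
     all (fun l => (size l <= K)%N && all (fun u => bitlen u.2 <= K)%N l) ls' /\
     all (fun n => n < K)%N a' &
     p * product_eval x ls a = p' * product_eval x ls' a'].
apply: (@texec_while _ I 1 (345 * K ^ 3) (size ls)).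
- by exists ls, a, p.
- by [].
- move=> r s1 [[|l ls'] [[|n a'] [p' [[s1l _ _ s1p] // _ _ _ ->]]]]; rewrite /= s1l //= => _.
  by rewrite s1p /product_eval /= big_nil mulr1.
- move=> r s1 [[|l ls'] [[|n a'] [p' [[s1l s1a s1x s1p] ss <- [lsK' aK'] pE]]]];
    rewrite /= s1l //= => _.
  exists (size ls') => //.
  move: lsK' aK' => /= /andP[/andP[lK' lb] lsK'] /andP[nK aK'].
  have K3 := K_le_exp 2; have K23 : (K ^ 2 <= K ^ 3)%N by rewrite leq_pexp2l.
  apply: (texec_assign_seq (335 * K ^ 3)); first by rewrite /=; move: K_gt0 K3; lia.
  apply: (texec_assign_seq (325 * K ^ 3)); first by rewrite /=; move: K_gt0 K3; lia.
  apply: (texec_assign_seq (315 * K ^ 3)).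
    by rewrite /= (_ : bitlen 0 = 1%N) //; move: K_gt0 K3; lia.
  apply: (texec_assign_seq (305 * K ^ 3)); first by rewrite /=; move: K_gt0 K3; lia.
  apply: (texec_assign_seq (295 * K ^ 3)); first by rewrite /=; move: K_gt0 K3; lia.
  apply: (texec_seq _ (250 * K ^ 3) (40 * K ^ 3)); first by move: K_gt0 K3; lia.
  set s2 := upd _ _ _.
  have := @monomial_loop_spec s2 l x 0; rewrite {1 2 3}/s2 /upd /= s1l s1x /=.
  move=> /(_ erefl erefl erefl lK' lb); apply: texec_conseq => // s3 s3v fr.
  have := @alpha_loop_spec s3 n p' (0 + sparse_eval x l); rewrite s3v !fr //.
  rewrite {1 2}/s2 /upd /= s1a s1p /= => /(_ erefl erefl erefl nK).
  apply: texec_conseq; first by rewrite leq_mul2l K23.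
  move=> s4 s4p fr4; exists ls', a', (p' * sparse_eval x l ^+ n).
  rewrite s4p add0r !fr4 // !fr // /s2 /upd /= s1l s1a s1x /=.
  split => //; first by case: ss.
  by rewrite pE /product_eval /= big_cons mulrA.
- by apply: (@loop_cost _ _ _ 350 3) => //; move: K_gt0 (K_le_exp 2); lia.
Qed.

(** * The loops over rows and points, and the whole program *)

Section Input.
Variables (ls : seq (seq (R * nat))) (rows : seq (seq nat)).
Hypothesis size_ls : (size ls <= K)%N.
Hypothesis size_rows : (size rows <= K)%N.
Hypothesis ls_le : all (fun l => (size l <= K)%N && all (fun u => bitlen u.2 <= K)%N l) ls.
Hypothesis rows_le : all (fun a => (size ls == size a) && all (fun n => n < K)%N a) rows.

Let polysV := vlist (map (@encode_sparse R) ls).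
Let rowsV := vlist [seq vlist (map VNat a) | a <- rows] : value R.

Definition input_eval (x : R) : R := \sum_(a <- rows) product_eval x ls a.

Lemma sum_loop_spec s (x y : R) :
  vhd (s 0%N) = polysV -> s xRows = rowsV -> s xReal = VReal x -> s xSum = VReal y ->
  texec R sum_loop s (1520 * K ^ 5) (fun s' => s' xSum = VReal (y + input_eval x)).
Proof.
move=> s0 sr sx sy.
pose I r s := exists rows' y',
 [/\ [/\ vhd (s 0%N) = polysV, s xRows = vlist [seq vlist (map VNat a) | a <- rows'],
     s xReal = VReal x & s xSum = VReal y'], size rows' = r,
     all (fun a => (size ls == size a) && all (fun n => n < K)%N a) rows' &
     y + input_eval x = y' + \sum_(a <- rows') product_eval x ls a].
apply: (@texec_while _ I 1 (755 * K ^ 4) (size rows)).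
- by exists rows, y.
- by [].
- move=> r s1 [[|a rows'] [y' [[_ s1r _ s1y] _ _ ->]]]; rewrite /= s1r //= => _.
  by rewrite s1y big_nil addr0.
- move=> r s1 [[|a rows'] [y' [[s10 s1r s1x s1y] <- rK yE]]]; rewrite /= s1r //= => _.
  exists (size rows') => //.
  move: rK => /= /andP[/andP[/eqP sa aK] rK].
  have K4 := K_le_exp 3.
  apply: (texec_assign_seq (745 * K ^ 4)); first by rewrite /= bitlen1; move: K_gt0 K4; lia.
  apply: (texec_assign_seq (735 * K ^ 4)); first by rewrite /=; move: K_gt0 K4; lia.
  apply: (texec_assign_seq (725 * K ^ 4)); first by rewrite /=; move: K_gt0 K4; lia.
  apply: (texec_assign_seq (715 * K ^ 4)); first by rewrite /=; move: K_gt0 K4; lia.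
  apply: (texec_seq _ (700 * K ^ 4) (10 * K ^ 4)); first by move: K_gt0 K4; lia.
  set s2 := upd _ _ _.
  have := @product_loop_spec s2 ls a x 1; rewrite {1 2 3 4}/s2 /upd /= s1r s1x s10 /=.
  move=> /(_ erefl erefl erefl erefl sa size_ls ls_le aK).
  apply: texec_conseq => // s3 s3p fr.
  apply: texec_assign; first by rewrite /=; move: K_gt0 K4; lia.
  exists rows', (y' + product_eval x ls a).
  rewrite /upd /= s3p !fr // /s2 /upd /= s10 s1r s1x s1y /= mul1r.
  by split => //; rewrite yE big_cons addrA.
- by apply: (@loop_cost _ _ _ 760 4) => //; move: K_gt0 (K_le_exp 3); lia.
Qed.

Lemma point_loop_spec s (N : nat) (b : bool) :
  s 0%N = VCons polysV rowsV -> s xPoint = VNat N -> (N < K)%N ->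
  truth (s xAnswer) = b ->
  texec R point_loop s (3240 * K ^ 6) (fun s' =>
    truth (s' xAnswer) = b && all (fun n => input_eval n%:R == 0) (iota 1 N)).
Proof.
move=> s0 sN NK sb.
(* The final verdict is the current answer together with the tests still pending at 1, ..., [r]. *)
pose I r s := [/\ s 0%N = VCons polysV rowsV, s xPoint = VNat r, (r < K)%N &
  b && all (fun n => input_eval n%:R == 0) (iota 1 N) =
  truth (s xAnswer) && all (fun n => input_eval n%:R == 0) (iota 1 r)].
apply: (@texec_while _ I (5 * K) (1600 * K ^ 5) N).
- by split=> //; rewrite sb.
- move=> r s1 [_ s1N rK _]; rewrite /= s1N /= bitlen1.
  by move: (bitlen_leS r) rK; lia.
- by move=> [|r] s1 [_ s1N _ ->]; rewrite /= s1N //= andbT.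
- move=> [|r] s1 [s10 s1N rK bE]; rewrite /= s1N //= => _.
  exists r => //; have := bitlen_leS r.+1 => br.
  have K5 := K_le_exp 4.
  apply: (texec_assign_seq (1590 * K ^ 5)).
    by rewrite /= s1N /=; move: K_gt0 K5 br rK; lia.
  apply: (texec_assign_seq (1580 * K ^ 5)).
    by rewrite /= (_ : bitlen 0 = 1%N) //; move: K_gt0 K5; lia.
  apply: (texec_assign_seq (1570 * K ^ 5)); first by rewrite /=; move: K_gt0 K5; lia.
  apply: (texec_seq _ (1520 * K ^ 5) (45 * K ^ 5)); first by move: K_gt0 K5; lia.
  set s2 := upd _ _ _.
  have := @sum_loop_spec s2 r.+1%:R 0; rewrite {1 2 3 4}/s2 /upd /= s10 s1N /=.
  move=> /(_ erefl erefl erefl erefl); rewrite add0r.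
  apply: texec_conseq => // s3 s3y fr.
  have s30 : s3 0%N = VCons polysV rowsV by rewrite fr // /s2 /upd /=.
  have s3N : s3 xPoint = VNat r.+1 by rewrite fr // /s2 /upd /=.
  have s3b : s3 xAnswer = s1 xAnswer by rewrite fr // /s2 /upd /=.
  have tail s4 : s4 0%N = VCons polysV rowsV -> s4 xPoint = VNat r.+1 ->
      truth (s4 xAnswer) = truth (s1 xAnswer) && (input_eval r.+1%:R == 0) ->
      texec R (xPoint ::= ENatOp NSub (EVar xPoint) (ENat 1)) s4 (10 * K ^ 5) (I r).
    move=> s40 s4N s4b; apply: texec_assign.
      by rewrite /= s4N /= bitlen1; move: K_gt0 br rK K5; lia.
    rewrite /I /upd /= s40 s4N /= subn1 s4b; split => //; first exact: ltnW.
    (* As the counter decreases, the point just tested is the last one of the pending list. *)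
    rewrite bE -{1}(addn1 r) iotaD all_cat /= andbT add1n.
    by rewrite -!andbA; congr (_ && _); rewrite andbC.
  apply: (texec_seq _ (30 * K ^ 5) (10 * K ^ 5)); first by move: K_gt0 K5; lia.
  have cost0 : (bitlen 0 = 1)%N by [].
  apply: (texec_if _ (20 * K ^ 5)); first by rewrite /= cost0; move: K_gt0 K5; lia.
  rewrite /= s3y /=; case: ifP => /= le0.
    apply: (texec_if _ (10 * K ^ 5)); first by rewrite /= cost0; move: K_gt0 K5; lia.
    rewrite /= s3y /=; case: ifP => /= ge0.
      apply: texec_skip; first by move: K_gt0 K5; lia.
      apply: tail => //; rewrite s3b (_ : (_ == 0)) ?andbT //.
      by rewrite eq_le; move: le0 ge0; do 2 case: (_ <= _).
    apply: texec_assign; first by move: K_gt0 K5; rewrite /=; lia.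
    apply: tail; rewrite /upd //=; apply/esym/negbTE; rewrite negb_and; apply/orP; right.
    by apply: contraFneq ge0 => ->; rewrite lexx.
  apply: texec_assign; first by move: K_gt0 K5; rewrite /=; lia.
  apply: tail; rewrite /upd //=; apply/esym/negbTE; rewrite negb_and; apply/orP; right.
  by apply: contraFneq le0 => ->; rewrite lexx.
- apply: (@loop_cost _ _ _ 1620 5); first exact: ltnW.
  by move: K_gt0 (K_le_exp 4); lia.
Qed.

Lemma count_monomials_loop_spec s (l : seq (R * nat)) (T : nat) :
  s xMonos = encode_sparse l -> s xCount = VNat T -> (T + size l < K)%N ->
  texec R count_monomials_loop s (30 * K ^ 2)
    (fun s' => s' xCount = VNat (T + size l)).
Proof.
move=> sl sT TK.
pose I r s := exists l' T', [/\ s xMonos = encode_sparse l', s xCount = VNat T',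
  size l' = r & (T + size l = T' + r)%N].
apply: (@texec_while _ I 1 (13 * K) (size l)).
- by exists l, T.
- by [].
- by move=> r s1 [[|u l'] [T' [s1l s1T <- ->]]]; rewrite /= s1l //= addn0.
- move=> r s1 [[|u l'] [T' [s1l s1T <- TE]]]; rewrite /= s1l //= => _.
  exists (size l') => //.
  have bT : (bitlen T' <= K)%N.
    by apply: leq_trans (bitlen_leS T') _; rewrite /= in TE; lia.
  apply: (texec_assign_seq (6 * K)).
    by rewrite /= s1T /= bitlen1; move: K_gt0; lia.
  apply: texec_assign; first by rewrite /=; move: K_gt0; lia.
  by exists l', T'.+1; rewrite /upd /= s1l s1T /= addn1 TE addSnnS.
- by apply: (@loop_cost _ _ _ 15 1); [lia|rewrite expn1; move: K_gt0; lia].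
Qed.

Definition monomial_count : nat := sumn [seq size l | l <- ls].

Lemma count_loop_spec s :
  s xPolys = polysV -> s xCount = VNat 0 -> (monomial_count < K)%N ->
  texec R count_loop s (100 * K ^ 3) (fun s' => s' xCount = VNat monomial_count).
Proof.
move=> sl sT TK.
pose I r s := exists ls' T', [/\ s xPolys = vlist (map (@encode_sparse R) ls'),
  s xCount = VNat T', size ls' = r &
  (monomial_count = T' + sumn [seq size l | l <- ls'])%N].
apply: (@texec_while _ I 1 (45 * K ^ 2) (size ls)).
- by exists ls, 0%N.
- by [].
- by move=> r s1 [[|l ls'] [T' [s1l s1T _ ->]]]; rewrite /= s1l //= addn0.
- move=> r s1 [[|l ls'] [T' [s1l s1T <- TE]]]; rewrite /= s1l //= => _.
  exists (size ls') => //; have K2 := K_le_exp 1.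
  apply: (texec_assign_seq (38 * K ^ 2)); first by rewrite /=; move: K_gt0 K2; lia.
  apply: (texec_assign_seq (31 * K ^ 2)); first by rewrite /=; move: K_gt0 K2; lia.
  set s2 := upd _ _ _.
  have := @count_monomials_loop_spec s2 l T'; rewrite {1 2}/s2 /upd /= s1l s1T /=.
  have h : (T' + size l < K)%N.
    by apply: leq_ltn_trans TK; rewrite TE /= addnA leq_addr.
  move=> /(_ erefl erefl h); apply: texec_conseq; first by rewrite leq_mul2r orbT.
  move=> s3 s3T fr; exists ls', (T' + size l)%N.
  by rewrite s3T !fr // /s2 /upd /= s1l /= TE /= addnA.
- by apply: (@loop_cost _ _ _ 50 2) => //; move: K_gt0 (K_le_exp 1); lia.
Qed.

(** The number of points and the cost of computing it stay abstract here: they come from a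
    polynomial that depends on the fixed [k] and [m]. *)
Lemma pit_program_spec s (points : expr) (N C : nat) :
  s 0%N = VCons polysV rowsV -> (monomial_count < K)%N -> (N < K)%N ->
  (forall s', s' xCount = VNat monomial_count ->
     eval s' points = VNat N /\ (ecost s' points <= C)%N) ->
  texec R (pit_program points) s (4000 * K ^ 6 + C) (fun s' =>
    truth (s' 0%N) = all (fun n => input_eval n%:R == 0) (iota 1 N)).
Proof.
move=> s0 TK NK hp.
have K6 := K_le_exp 5; have K36 : (K ^ 3 <= K ^ 6)%N by rewrite leq_pexp2l.
apply: (texec_assign_seq (3900 * K ^ 6 + C)); first by rewrite /=; move: K_gt0 K6; lia.
apply: (texec_assign_seq (3800 * K ^ 6 + C)); first by rewrite /=; move: K_gt0 K6; lia.
apply: (texec_seq _ (100 * K ^ 3) (3600 * K ^ 6 + C)); first by move: K_gt0 K6; lia.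
set s1 := upd _ _ _.
have := @count_loop_spec s1; rewrite {1 2}/s1 /upd /= s0 /= => /(_ erefl erefl TK).
apply: texec_conseq => // s2 s2T fr; have [eN eC] := hp _ s2T.
apply: (texec_assign_seq (3500 * K ^ 6)); first by move: K_gt0 K6; lia.
apply: (texec_assign_seq (3400 * K ^ 6)); first by rewrite /=; move: K_gt0 K6; lia.
apply: (texec_seq _ (3240 * K ^ 6) (100 * K ^ 6)); first by move: K_gt0 K6; lia.
set s3 := upd _ _ _.
have := @point_loop_spec s3 N true; rewrite {1 2 3}/s3 /upd /= fr // eN.
rewrite /s1 /upd /= => /(_ s0 erefl NK erefl); apply: texec_conseq => // s4 s4b _.
by apply: texec_assign; [rewrite /=; move: K_gt0 K6; lia|rewrite /upd /=].
Qed.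

End Input.
End Correctness.

(** * The number of evaluation points as a polynomial computed by the program *)

Lemma leq_horner_nat (p : {poly nat}) (a b : nat) : (a <= b)%N -> (p.[a] <= p.[b])%N.
Proof.
move=> ab; rewrite !horner_coef; elim/big_ind2: _ => //.
  by move=> x1 x2 y1 y2 h1 h2; rewrite !(natrDE, natrME, natrXE) leq_add.
move=> i _; rewrite !(natrME, natrXE) leq_mul //.
by case: (nat_of_ord i) => [|e] //; rewrite leq_exp2r.
Qed.

(** For fixed [m] and [k], [root_bound] is a fixed polynomial in [t]; the sparsity argument becomes
    the polynomial [q]. *)
Fixpoint root_bound_poly (m k : nat) (q : {poly nat}) : {poly nat} :=
  if k is k'.+1 then
    (q + m%:P * 'X) *+ 2 + (m%:P * 'X +
      root_bound_poly m k' (q + (m.+1%:P * 'X^m * q ^+ 2) *+ 2)) + 1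
  else 0.

Lemma horner_root_bound_poly (m k t : nat) (q : {poly nat}) :
  (root_bound_poly m k q).[t] = root_bound m t k q.[t].
Proof.
elim: k q => [|k IH] q /=; first by rewrite horner0.
rewrite !(hornerD, hornerMn, hornerM, hornerC, hornerX) IH.
rewrite !(hornerD, hornerMn, hornerM, hornerC, hornerXn, horner_exp).
by rewrite !mulr2n !(natrDE, natrME, natrXE) !addnn addn1.
Qed.

(** Programs may contain natural constants, so a fixed polynomial in [xCount] becomes a single
    loop-free expression by Horner's scheme. *)
Fixpoint horner_expr (q : seq nat) : expr :=
  if q is c :: q' then
    ENatOp NAdd (ENatOp NMul (horner_expr q') (EVar xCount)) (ENat c)
  else ENat 0.

Lemma horner_exprE (R : realType) (s : store R) (T : nat) (q : seq nat) :
  s xCount = VNat T -> eval s (horner_expr q) = VNat (horner_rec q T).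
Proof. by move=> sT; elim: q => //= c q ->; rewrite sT. Qed.

Lemma horner_expr_cost (R : realType) (q : seq nat) :
  exists p : {poly nat}, forall (s : store R) (T : nat),
    s xCount = VNat T -> (ecost s (horner_expr q) <= p.[T])%N.
Proof.
elim: q => [|c q [p IH]]; first by exists 1 => s T _; rewrite hornerC.
(* [p] pays for the inner expression; the other terms bound the bit lengths of the operands
   [horner_rec q T], [T], their product and [c] by the values themselves, and the unit costs. *)
exists (p + Poly q + 'X + Poly q * 'X + (10 + c)%N%:P) => s T sT /=.
have h := IH s T sT; rewrite (horner_exprE _ _ _ q sT) sT /=.
rewrite !(hornerD, hornerM, hornerX, hornerC) !horner_Poly !(natrDE, natrME, natrXE).
have := bitlen_leS (horner_rec q T * T); have := bitlen_leS (horner_rec q T).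
have := bitlen_leS T; have := bitlen_leS c; move: h.
by move: (horner_rec q T : nat) => r; lia.
Qed.
Theorem theorem4 (R : realType) (k m : nat) (hk : (1 <= k)%N) (hm : (1 <= m)%N) :
  exists (P : cmd) (p : {poly nat}),
  forall (t : nat) (f : 'I_m -> {poly R}) (l : 'I_m -> seq (R * nat))
         (alpha : 'I_k -> 'I_m -> nat),
    (forall j, f j != 0) ->
    (forall j, t_sparse t (f j)) ->
    (forall j, sparse_rep (l j) (f j)) ->
    exists (b : bool) (n : nat),
      [/\ runs P (encode_input l alpha) b n,
          (b = true <-> \sum_(i < k) \prod_(j < m) f j ^+ alpha i j = 0) &
          (n <= p.[(t + \sum_(j < m) sparse_size (l j)
                     + \sum_(i < k) \sum_(j < m) alpha i j)%N])%N].
Proof.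
(* The initial coefficients 1 are 1-sparse; the added 1 makes the number of points exceed the root
   bound. *)
pose q := root_bound_poly m k 1 + 1.
have [cp cpP] := horner_expr_cost R q.
(* [Kp] at the input size bounds everything at once: ['X] the monomial count, bit lengths and
   [alpha], the constant the numbers of polynomials and rows, [q] the number of points. The constant
   also makes the bounds strict. *)
pose Kp : {poly nat} := 'X + (k + m + 2)%N%:P + q.
exists (pit_program (horner_expr q)), (4000%N%:P * Kp ^+ 6 + cp).
move=> t f l alpha f0 _ fl.
set S := (t + _ + _)%N.
pose ls := [seq l j | j <- enum 'I_m].
pose rows := [seq [seq alpha i j | j <- enum 'I_m] | i <- enum 'I_k].
pose T := monomial_count R ls.
have TE : T = (\sum_(j < m) size (l j))%N.
  by rewrite /T /monomial_count /ls sumnE 2!big_map big_enum.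
have size_le j : (size (l j) <= sparse_size (l j))%N.
  by rewrite -sum1_size; apply: leq_sum.
have sparse_le j : (sparse_size (l j) <= S)%N.
  by rewrite /S -addnA addnCA (bigD1 j) //= -!addnA leq_addr.
have TS : (T <= S)%N.
  have h : (T <= \sum_(j < m) sparse_size (l j))%N by rewrite TE; apply: leq_sum.
  by apply: leq_trans h _; rewrite /S; lia.
have size_T j : (size (l j) <= T)%N by rewrite TE (bigD1 j) //= leq_addr.
have alpha_le i j : (alpha i j <= S)%N.
  apply: leq_trans (leq_addl _ _).
  by rewrite (bigD1 i) //= (bigD1 j) //= -addnA leq_addr.
pose K := (S + (k + m + 2) + q.[S])%N.
have KE : Kp.[S] = K by rewrite /Kp 2!hornerD hornerX hornerC.
have qTS : (q.[T] <= q.[S])%N by exact: leq_horner_nat.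
(* What the program computes from the lists is the value of the polynomial in question at [x]. *)
have evalE (x : R) : input_eval R ls rows x = (\sum_(i < k) powprod R m f (alpha i)).[x].
  rewrite /input_eval big_map big_enum horner_sum; apply: eq_bigr => i _.
  rewrite /product_eval zip_map big_map big_enum horner_prod; apply: eq_bigr => j _.
  rewrite horner_exp /=; congr (_ ^+ _); have [_ _ ->] := fl j.
  rewrite horner_sum; apply: eq_bigr => u _.
  by rewrite hornerZ hornerXn.
have [|||||||||n [s' [ex nB ans]]] := @pit_program_spec R K _ ls rows _ _ _ _
  (upd (fun=> VNil) 0 (encode_input l alpha)) (horner_expr q) q.[T] cp.[T].
- by rewrite /K; lia.
- by rewrite size_map size_enum_ord /K; lia.
- by rewrite size_map size_enum_ord /K; lia.
- apply/allP => l' /mapP[j _ ->]; apply/andP; split.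
    by apply: leq_trans (size_T j) _; rewrite /K; lia.
  apply/allP => u ul; apply: leq_trans (_ : (sparse_size (l j) <= _)%N); last first.
    by apply: leq_trans (sparse_le j) _; rewrite /K; lia.
  by rewrite /sparse_size (big_rem u) //=; lia.
- apply/allP => a /mapP[i _ ->]; rewrite !size_map eqxx /=.
  by apply/allP => b /mapP[j _ ->]; have := alpha_le i j; rewrite /K; lia.
- rewrite /upd /= /encode_input; congr (VCons (vlist _) (vlist _)).
    exact: (map_comp (@encode_sparse R) l).
  rewrite /rows -(map_comp (fun a => vlist (map VNat a))).
  by apply: eq_map => i; congr vlist; exact: (map_comp VNat (alpha i)).
- by rewrite -/T /K; lia.
- by rewrite /K; lia.
- by move=> s1 s1T; split; [exact: horner_exprE|exact: cpP].
exists (truth (s' 0%N)), n; split; first by exists s'.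
- rewrite ans; split => [/allP h|phi0].
    (* The root bound is used with the counted [T] as sparsity, witnessed by the given lists
       [l j]. *)
    apply: (@sum_powprod_eq0 R m f T f0 _ k q.[T]).
    + by move=> j; have [_ _ ->] := fl j; exists (l j).
    + by rewrite /q hornerD horner_root_bound_poly !hornerC natrDE addn1.
    + move=> i iN; rewrite rootE -evalE; apply: h.
      by rewrite mem_iota add1n ltnS.
  by apply/allP => i _; rewrite evalE [X in X.[_]]phi0 horner0.
- apply: leq_trans nB _; rewrite hornerD hornerM horner_exp hornerC KE.
  rewrite !(natrDE, natrME, natrXE).
  by rewrite leq_add2l leq_horner_nat.
Qed.
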